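(* Let $A,B\in\mathbb{R}_{\max}^{m\times n}$ be doubly $\mathbb{R}$-astic with rows $A_i,B_i$, and let $S(A,B)=\{\bm{x}\in\mathbb{R}_{\max}^n\mid A\otimes\bm{x}=B\otimes\bm{x}\}$. Assume every $\bm{x}\in S(A,B)$ is stable (i.e. $\varphi_0(\bm{x})=\bm{x}$) and $S(A,B)$ is projectively bounded. Let $C=-(A\oplus B)$ with rows $C_1,\dots,C_m$, and assume $\varphi(C_i^T)$ is defined for each $i$. If $\varphi(C_i^T)\in R(A_i,B_i)$ for all $i\in[m]$, then $S(A,B)$ is min-plus linear.
   Context: $\mathbb{R}_{\max}=\mathbb{R}\cup\{\varepsilon\}$, $\varepsilon=-\infty$, $\oplus=\max$, $\otimes=+$; $\mathbb{R}_{\min}=\mathbb{R}\cup\{\varepsilon'\}$, $\varepsilon'=+\infty$, $\oplus'=\min$, $\otimes'=+$; conventions $\varepsilon\otimes\varepsilon'=\varepsilon$, $\varepsilon\otimes'\varepsilon'=\varepsilon'$, $\varepsilon\oplus\varepsilon'=\varepsilon'$, $\varepsilon\oplus'\varepsilon'=\varepsilon$; operations extend to matrices/vectors as in ordinary linear algebra; $-M^T=(-m_{ji})$, $-\varepsilon=\varepsilon'$. $\bm{\varepsilon}$, $\bm{\varepsilon}'$ are the all-$\varepsilon$, all-$\varepsilon'$ vectors. Doubly $\mathbb{R}$-astic: every row and column has a real entry. $\varphi_0(\bm{x})=(-A^T\oplus'-B^T)\otimes'((A\otimes\bm{x})\oplus'(B\otimes\bm{x}))$; stable means $\varphi_0(\bm{x})=\bm{x}$.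 $\varphi(\bm{x})$: the first $\bm{x}(r)$ with $\bm{x}(r+1)=\bm{x}(r)$ in the iteration $\bm{x}(0)=\bm{x}$, $\bm{x}(r+1)=\varphi_0(\bm{x}(r))$ (alternating method). A max-plus subspace $V\subset\mathbb{R}_{\max}^n$ is projectively bounded if $V\subset\mathbb{R}^n\cup\{\bm{\varepsilon}\}$; such $V$ is min-plus linear if $(V\setminus\{\bm{\varepsilon}\})\cup\{\bm{\varepsilon}'\}$ is closed under $\oplus'$ and under $\bm{x}\mapsto a\otimes'\bm{x}$ for $a\in\mathbb{R}_{\min}$. For row vectors $\bm{a}=(a_1,\dots,a_n),\bm{b}=(b_1,\dots,b_n)\in\mathbb{R}_{\max}^{1\times n}$, $R(\bm{a},\bm{b})$ is the set of $\bm{x}\in\mathbb{R}^n$ with $\bm{a}\otimes\bm{x}=\bm{b}\otimes\bm{x}$ satisfying at least one of: (1) there exist $i\ne j$ with $\bm{a}\otimes\bm{x}=a_i\otimes x_i>a_k\otimes x_k$ for all $k\ne i$ and $\bm{b}\otimes\bm{x}=b_j\otimes x_j>b_k\otimes x_k$ for all $k\ne j$; (2) there exists $i$ with $\bm{a}\otimes\bm{x}=a_i\otimes x_i$ and $\bm{b}\otimes\bm{x}=b_i\otimes x_i>b_k\otimes x_k$ for all $k\ne i$; (3) for every $i\in[n]$, $\bm{a}\otimes\bm{x}=a_i\otimes x_i$ iff $\bm{b}\otimes\bm{x}=b_i\otimes x_i$. *)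

(* Defs.v *)
From HB Require Import structures.
From mathcomp Require Import all_boot all_order all_algebra.
From mathcomp Require Import boolp classical_sets.
From mathcomp Require Import reals constructive_ereal.

Set Implicit Arguments.
Unset Strict Implicit.
Unset Printing Implicit Defensive.

Import Order.TTheory GRing.Theory Num.Theory.

Local Open Scope classical_set_scope.
Local Open Scope ring_scope.

(* Both R_max (the elements <> +oo) and R_min (the elements <> -oo) are viewed
   inside \bar R, because the operator phi0 below mixes entries of both.
   The conventions on infinities are those of \bar R: -oo + +oo is -oo for the
   addition of \bar R and +oo for the dual addition [dual_adde]. *)

Definition Rmax_mx {R : realType} {m n : nat} (A : 'M[\bar R]_(m, n)) : Prop :=
  forall i j, A i j <> +oo%E.

Definition real_mx {R : realType} {m n : nat} (A : 'M[\bar R]_(m, n)) : Prop :=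
  forall i j, A i j \is a fin_num.

Definition doubly_astic {R : realType} {m n : nat} (A : 'M[\bar R]_(m, n)) :
    Prop :=
  (forall i, exists j, A i j \is a fin_num) /\
  (forall j, exists i, A i j \is a fin_num).

Definition maxplus_add {R : realType} {m n : nat} (A B : 'M[\bar R]_(m, n)) :
  'M[\bar R]_(m, n) := map2_mx maxe A B.

Definition minplus_add {R : realType} {m n : nat} (A B : 'M[\bar R]_(m, n)) :
  'M[\bar R]_(m, n) := map2_mx mine A B.

Definition maxplus_mul {R : realType} {m n p : nat}
    (A : 'M[\bar R]_(m, n)) (B : 'M[\bar R]_(n, p)) : 'M[\bar R]_(m, p) :=
  \matrix_(i, k) \big[maxe/-oo%E]_(j < n) (A i j + B j k)%E.

Definition minplus_mul {R : realType} {m n p : nat}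
    (A : 'M[\bar R]_(m, n)) (B : 'M[\bar R]_(n, p)) : 'M[\bar R]_(m, p) :=
  \matrix_(i, k) \big[mine/+oo%E]_(j < n) dual_adde (A i j) (B j k).

Definition minplus_scale {R : realType} {m n : nat} (a : \bar R)
    (A : 'M[\bar R]_(m, n)) : 'M[\bar R]_(m, n) :=
  map_mx (dual_adde a) A.

Definition neg_mx {R : realType} {m n : nat} (A : 'M[\bar R]_(m, n)) :
  'M[\bar R]_(m, n) := map_mx oppe A.

Definition sol_set {R : realType} {m n : nat} (A B : 'M[\bar R]_(m, n)) :
    set 'cV[\bar R]_n :=
  [set x | Rmax_mx x /\ maxplus_mul A x = maxplus_mul B x].

Definition phi0 {R : realType} {m n : nat} (A B : 'M[\bar R]_(m, n))
    (x : 'cV[\bar R]_n) : 'cV[\bar R]_n :=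
  minplus_mul (minplus_add (neg_mx A^T) (neg_mx B^T))
              (minplus_add (maxplus_mul A x) (maxplus_mul B x)).

Definition stable {R : realType} {m n : nat} (A B : 'M[\bar R]_(m, n))
    (x : 'cV[\bar R]_n) : Prop := phi0 A B x = x.

Definition phi_defined {R : realType} {m n : nat} (A B : 'M[\bar R]_(m, n))
    (x : 'cV[\bar R]_n) : Prop :=
  exists r, iter r.+1 (phi0 A B) x == iter r (phi0 A B) x.

(* The alternating method; [ex_minn h] is the first r with x(r+1) = x(r). *)
Definition phi {R : realType} {m n : nat} (A B : 'M[\bar R]_(m, n))
    (x : 'cV[\bar R]_n) (h : phi_defined A B x) : 'cV[\bar R]_n :=
  iter (ex_minn h) (phi0 A B) x.

Definition projectively_bounded {R : realType} {n : nat}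
    (V : set 'cV[\bar R]_n) : Prop :=
  V `<=` [set x | real_mx x] `|` [set const_mx -oo%E].

Definition minplus_closed {R : realType} {n : nat} (W : set 'cV[\bar R]_n) :
    Prop :=
  (forall x y, W x -> W y -> W (minplus_add x y)) /\
  (forall a x, a <> -oo%E -> W x -> W (minplus_scale a x)).

Definition minplus_linear {R : realType} {n : nat} (V : set 'cV[\bar R]_n) :
    Prop :=
  minplus_closed ((V `\` [set const_mx -oo%E]) `|` [set const_mx +oo%E]).

Definition dot {R : realType} {n : nat} (a : 'rV[\bar R]_n)
    (x : 'cV[\bar R]_n) : \bar R := maxplus_mul a x ord0 ord0.

Definition term {R : realType} {n : nat} (a : 'rV[\bar R]_n)
    (x : 'cV[\bar R]_n) (i : 'I_n) : \bar R := (a ord0 i + x i ord0)%E.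

Definition Rset {R : realType} {n : nat} (a b : 'rV[\bar R]_n) :
    set 'cV[\bar R]_n :=
  [set x | [/\ real_mx x, maxplus_mul a x = maxplus_mul b x &
    [\/ exists i j,
          [/\ i != j,
              dot a x = term a x i,
              (forall k, k != i -> term a x k < term a x i)%E,
              dot b x = term b x j &
              (forall k, k != j -> term b x k < term b x j)%E],
        exists i,
          [/\ dot a x = term a x i,
              dot b x = term b x i &
              (forall k, k != i -> term b x k < term b x i)%E] |
        forall i, dot a x = term a x i <-> dot b x = term b x i]]].

(* Main.v *)
(* Write v_i = phi(C_i^T). Since phi_0 is monotone and C_i^T is the greatest
   vector with (A \oplus B)_i x <= 0, v_i is the greatest element of S(A, B) with
   A_i x = B_i x = 0, so x <= A_i x + v_i for every x in S(A, B). In cases (1) and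
   (2) of R(A_i, B_i) some columns p, q attaining A_i v_i and B_i v_i satisfy
   x_p = A_i x + v_ip and x_q = A_i x + v_iq for every solution x, and row i
   visibly holds at the minimum of two solutions. In case (3), every column k is
   dominated by a column p active at v_i: x_k - v_ik <= x_p - v_ip for all
   solutions x. The minimum of two solutions inherits this, so the active
   columns, which are the same on both sides, decide row i. *)
Require Import Defs.
From mathcomp Require Import all_boot all_order all_algebra.
From mathcomp Require Import boolp classical_sets.
From mathcomp Require Import reals constructive_ereal.
From mathcomp Require Import lra.
Import Order.TTheory GRing.Theory Num.Theory.

Set Implicit Arguments.
Unset Strict Implicit.
Unset Printing Implicit Defensive.

Local Open Scope ring_scope.

(** * Max-plus row equations at real vectors *)

(** Encodes [max_k (f k + x k) = c] for real [x] and [c]. Moving [x k] across keeps the arithmetic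
    real, and the bound rules out [+oo] entries. *)
Definition attains (R : realType) (T : finType) (f : T -> \bar R)
    (x : T -> R) (c : R) : Prop :=
  (forall k, (f k <= (c - x k)%:E)%E) /\ (exists k, f k = (c - x k)%:E).

Definition solves (R : realType) (I T : finType) (a b : I -> T -> \bar R)
    (x : T -> R) : Prop :=
  forall i, exists c, attains (a i) x c /\ attains (b i) x c.

Lemma attains_uniq (R : realType) (T : finType) (f : T -> \bar R) x c d :
  attains f x c -> attains f x d -> c = d.
Proof.
move=> [cub [k kE]] [dub [l lE]].
have := dub k; have := cub l; rewrite kE lE !lee_fin; lra.
Qed.

Lemma finite_small (R : realType) (I : finType) (P : I -> R -> Prop) :
  (forall i, exists2 t, 0 < t & forall s, s <= t -> P i s) ->
  exists2 t, 0 < t & forall s, s <= t -> forall i, P i s.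
Proof.
move=> tP.
have /choice[g gP] i : exists t, 0 < t /\ forall s, s <= t -> P i s.
  by have [t] := tP i; exists t.
exists (\big[Num.min/1]_i g i) => [|s s_le i].
  by apply: lt_bigmin => // i _; case: (gP i).
by apply: (gP i).2; apply: le_trans s_le _; exact: bigmin_le.
Qed.

(** The finitely many inactive terms leave a positive gap below [c]. Allowing every [s <= t] lets
    the gaps of several rows be merged into one. *)
Lemma attains_gap (R : realType) (T : finType) (f : T -> \bar R) x c :
  attains f x c -> exists2 t, 0 < t &
    forall s, s <= t -> forall k,
      f k = (c - x k)%:E \/ (f k <= (c - x k - s)%:E)%E.
Proof.
move=> [ub _]; apply: finite_small => k.
move: (ub k); rewrite le_eqVlt => /predU1P[->|].
  by exists 1 => // s _; left.
case: (f k) => [r| |]; last 1 first.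
- by exists 1 => // s _; right; rewrite leNye.
- rewrite lte_fin => r_lt; exists (c - x k - r); first by lra.
  by move=> s s_le; right; rewrite lee_fin; lra.
- by [].
Qed.

(** Inactive terms have room [t], so raising [x] by [t] on [J] raises the value only when [J]
    contains an active column, and then by exactly [t]. *)
Lemma attains_bump (R : realType) (T : finType) (f : T -> \bar R) x c t
    (J : pred T) :
  0 < t -> attains f x c ->
  (forall k, f k = (c - x k)%:E \/ (f k <= (c - x k - t)%:E)%E) ->
  attains f (fun k => x k + (if J k then t else 0))
    (c + (if [exists k, J k && (f k == (c - x k)%:E)] then t else 0)).
Proof.
move=> t0 [ub [k0 k0E]] gap; case: ifP => [/existsP[k1 /andP[Jk1 /eqP k1E]]|].
  split=> [k|]; last by exists k1; rewrite Jk1 k1E; congr EFin; lra.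
  by apply: le_trans (ub k) _; rewrite lee_fin; case: ifP => _; lra.
move=> /existsPn noJ; split=> [k|].
  case: ifP => Jk; last by apply: le_trans (ub k) _; rewrite lee_fin; lra.
  case: (gap k) => [kE|fk]; last by apply: le_trans fk _; rewrite lee_fin; lra.
  by have := noJ k; rewrite Jk kE eqxx.
exists k0; have := noJ k0; rewrite k0E eqxx andbT => /negbTE ->.
by congr EFin; lra.
Qed.

(** * Generators and closure of the solutions under minimum *)

(* Met by [v i = phi (C_i^T)]. The left disjunct of [gen_cases] covers cases (1)
   and (2) of [R(A_i, B_i)], the right one is case (3). *)
Record generators (R : realType) (I T : finType) (a b : I -> T -> \bar R)
    (v : I -> T -> R) : Prop := Generators {
  gen_sol : forall i, solves a b (v i);
  gen_l : forall i, attains (a i) (v i) 0;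
  gen_r : forall i, attains (b i) (v i) 0;
  gen_max : forall i x c k, solves a b x -> attains (a i) x c ->
    x k <= c + v i k;
  gen_cases : forall i,
    (exists p q, [/\ a i p = (0 - v i p)%:E, b i q = (0 - v i q)%:E &
       forall x c, solves a b x -> attains (a i) x c ->
         x p = c + v i p /\ x q = c + v i q]) \/
    (forall k, a i k = (0 - v i k)%:E <-> b i k = (0 - v i k)%:E) }.

(* If no active [p] works for [k], let [J] be the set of such columns. A row with
   an active column in [J] on one side has one on the other side too, so [v i]
   raised by a small [t] on [J] is still a solution; row [i] does not see the
   change, which contradicts the maximality of [v i]. *)
Lemma generators_dominated (R : realType) (I T : finType)
    (a b : I -> T -> \bar R) (v : I -> T -> R) i :
  generators a b v -> forall k, exists2 p, a i p = (0 - v i p)%:E &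
    forall x, solves a b x -> x k - v i k <= x p - v i p.
Proof.
move=> G; set u := v i.
pose dom k p := forall x, solves a b x -> x k - u k <= x p - u p.
apply: contrapT => /existsNP[k0 k0P].
pose J k := `[< ~ exists2 p, a i p = (0 - u p)%:E & dom k p >].
have Jdom k q : J k -> dom k q -> J q.
  move=> /asboolP Jk kq; apply/asboolP => -[p pE qp]; apply: Jk.
  by exists p => // x xS; apply: le_trans (kq x xS) (qp x xS).
have uS : solves a b u := gen_sol G i.
(* Since [u <= c + v r], a column [k] active for [u] in row [r] satisfies [u k = c + v r k], hence
   is active for [v r] as well. *)
have meets r c : attains (a r) u c -> attains (b r) u c ->
    [exists k, J k && (a r k == (c - u k)%:E)] =
    [exists k, J k && (b r k == (c - u k)%:E)].
  move=> au bu.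
  have le_v k := gen_max G k uS au.
  case: (gen_cases G r) => [[p [q [pE qE pin]]]|same].
    have [up uq] := pin _ _ uS au.
    (* If [x] has value [d] in row [r], then [x k - u k <= d - c = x s - u s]. *)
    have edge k s : u k = c + v r k -> u s = c + v r s ->
      (forall x d, solves a b x -> attains (a r) x d -> x s = d + v r s) ->
      dom k s.
      move=> uk us pins x xS; have [d [ax _]] := xS r.
      by have := gen_max G k xS ax; have := pins x d xS ax; lra.
    apply/existsP/existsP => -[k /andP[Jk /eqP kE]].
      exists q; rewrite (Jdom k) //=; last first.
        apply: edge => //; last by move=> x d xS ax; case: (pin x d xS ax).
        have := (gen_l G r).1 k; rewrite kE lee_fin; have := le_v k; lra.
      by rewrite qE; apply/eqP; congr EFin; lra.
    exists p; rewrite (Jdom k) //=; last first.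
      apply: edge => //; last by move=> x d xS ax; case: (pin x d xS ax).
      have := (gen_r G r).1 k; rewrite kE lee_fin; have := le_v k; lra.
    by rewrite pE; apply/eqP; congr EFin; lra.
  have shift k : u k = c + v r k -> (c - u k)%:E = (0 - v r k)%:E.
    by move=> ->; congr EFin; lra.
  apply: eq_existsb => k; congr (_ && _); apply/eqP/eqP => kE.
    have /shift cE : u k = c + v r k.
      by have := (gen_l G r).1 k; rewrite kE lee_fin; have := le_v k; lra.
    by rewrite cE in kE *; exact/(same k).1.
  have /shift cE : u k = c + v r k.
    by have := (gen_r G r).1 k; rewrite kE lee_fin; have := le_v k; lra.
  by rewrite cE in kE *; exact/(same k).2.
have [t t0 gap] : exists2 t, 0 < t & forall s, s <= t -> forall r, forall c,
    attains (a r) u c -> attains (b r) u c -> forall k,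
      (a r k = (c - u k)%:E \/ (a r k <= (c - u k - s)%:E)%E) /\
      (b r k = (c - u k)%:E \/ (b r k <= (c - u k - s)%:E)%E).
  apply: finite_small => r; have [c [au bu]] := uS r.
  have [t1 t10 gap1] := attains_gap au; have [t2 t20 gap2] := attains_gap bu.
  exists (Num.min t1 t2); first by rewrite lt_min t10.
  move=> s; rewrite le_min => /andP[s1 s2] d ad _ k.
  by rewrite (attains_uniq ad au); split; [exact: gap1|exact: gap2].
pose w k := u k + (if J k then t else 0).
have wS : solves a b w.
  move=> r; have [c [au bu]] := uS r.
  exists (c + (if [exists k, J k && (a r k == (c - u k)%:E)] then t else 0)).
  split; last rewrite meets //.
    by apply: attains_bump => // k; case: (gap t _ r c au bu k).
  by apply: attains_bump => // k; case: (gap t _ r c au bu k).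
have aw : attains (a i) w 0.
  (* An active column of row [i] dominates itself, so none lies in [J]. *)
  have noJ : [exists k, J k && (a i k == (0 - u k)%:E)] = false.
    apply/negbTE/existsPn => k; apply/negP => /andP[/asboolP Jk /eqP kE].
    by apply: Jk; exists k.
  have := @attains_bump _ _ (a i) u 0 t J t0 (gen_l G i).
  rewrite noJ addr0; apply => k.
  by case: (gap t _ i 0 (gen_l G i) (gen_r G i) k).
have Jk0 : J k0 by apply/asboolP.
have := gen_max G k0 wS aw; rewrite /w Jk0 -/u; lra.
Qed.

Lemma solves_min (R : realType) (I T : finType)
    (a b : I -> T -> \bar R) (v : I -> T -> R) x y :
  generators a b v -> solves a b x -> solves a b y ->
  solves a b (fun k => Num.min (x k) (y k)).
Proof.
move=> G xS yS i.
case: (gen_cases G i) => [[p [q [pE qE pin]]]|same].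
  have [c [ax bx]] := xS i; have [d [ay by_]] := yS i.
  have [xp xq] := pin _ _ xS ax; have [yp yq] := pin _ _ yS ay.
  have ub (f : T -> \bar R) k : (f k <= (c - x k)%:E)%E ->
      (f k <= (d - y k)%:E)%E ->
      (f k <= (Num.min c d - Num.min (x k) (y k))%:E)%E.
    case: (f k) => [r| |]; rewrite ?leNye // !lee_fin.
    by case: (leP c d); case: (leP (x k) (y k)); lra.
  (* At [p] and [q] the minimum equals [Num.min c d + v i], so [p] stays active on the left and [q]
     on the right. *)
  exists (Num.min c d); split.
    split=> [k|]; first exact: ub (ax.1 k) (ay.1 k).
    exists p; rewrite pE xp yp; congr EFin.
    by case: (leP c d); case: (leP (c + v i p) (d + v i p)); lra.
  split=> [k|]; first exact: ub (bx.1 k) (by_.1 k).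
  exists q; rewrite qE xq yq; congr EFin.
  by case: (leP c d); case: (leP (c + v i q) (d + v i q)); lra.
pose z k := Num.min (x k) (y k); rewrite -/z.
have [k0 /eqP k0E] := (gen_l G i).2.
(* Here [p] maximizes [z - v i] among active columns only; domination, which survives the minimum,
   extends this to all columns. *)
case: (@arg_maxP _ _ _ k0 (fun p => a i p == (0 - v i p)%:E)
  (fun p => z p - v i p) k0E) => p /eqP pE p_max.
have zmax k : z k - v i k <= z p - v i p.
  have [q qE qdom] := generators_dominated i G k.
  apply: le_trans (p_max q _); last by rewrite qE.
  have := qdom x xS; have := qdom y yS; rewrite /z.
  by case: (leP (x k) (y k)); case: (leP (x q) (y q)); lra.
exists (z p - v i p); split; split=> [k|].
- by apply: le_trans ((gen_l G i).1 k) _; rewrite lee_fin; have := zmax k; lra.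
- by exists p; rewrite pE; congr EFin; lra.
- by apply: le_trans ((gen_r G i).1 k) _; rewrite lee_fin; have := zmax k; lra.
- by exists p; rewrite (same p).1 //; congr EFin; lra.
Qed.

(** * From real vectors to matrices over [\bar R] *)

Lemma lee_add_EFin (R : realType) (f : \bar R) (x c : R) :
  (f + x%:E <= c%:E)%E = (f <= (c - x)%:E)%E.
Proof. by rewrite EFinB leeBrDr. Qed.

Lemma add_eq_EFin (R : realType) (f : \bar R) (x c : R) :
  (f + x%:E)%E = c%:E <-> f = (c - x)%:E.
Proof.
split=> [fx|->]; last by rewrite -EFinD subrK.
by rewrite EFinB -fx addeK.
Qed.

Lemma attainsP (R : realType) m n (A : 'M[\bar R]_(m, n)) i (x : 'I_n -> R) c :
  attains (A i) x c <-> maxplus_mul A (\col_k (x k)%:E) i ord0 = c%:E.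
Proof.
have termE k : (A i k + (\col_k0 (x k0)%:E) k ord0 = A i k + (x k)%:E)%E.
  by rewrite mxE.
rewrite mxE; under eq_bigr => k _ do rewrite termE.
split=> [[ub [k kE]]|mE].
  apply/eqP; rewrite eq_le; apply/andP; split.
    by apply: bigmax_le => [|j _]; rewrite ?leNye // lee_add_EFin.
  by apply: (bigmax_sup k) => //; rewrite ((add_eq_EFin _ _ _).2 kE).
have ub k : (A i k <= (c - x k)%:E)%E.
  by rewrite -lee_add_EFin -mE; exact: (le_bigmax _ (fun k => A i k + (x k)%:E)%E).
split=> //.
(* A real maximum cannot be the default [-oo], so some term reaches it. *)
have /bigmax_geP[|[k _]] : (c%:E <= \big[maxe/-oo]_(k < n) (A i k + (x k)%:E))%E.
- by rewrite mE.
- by rewrite leeNy_eq.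
move=> ck; exists k; apply/add_eq_EFin/eqP; rewrite eq_le ck andbT.
by rewrite lee_add_EFin.
Qed.

(** The real entry keeps the row value above [-oo], and the absence of [+oo] entries keeps it below
    [+oo]. *)
Lemma attains_exists (R : realType) m n (A : 'M[\bar R]_(m, n)) i x :
  Rmax_mx A -> (exists j, A i j \is a fin_num) ->
  exists c, attains (A i) x c.
Proof.
move=> AR [j Aij].
suff /fineK cE : maxplus_mul A (\col_k (x k)%:E) i ord0 \is a fin_num.
  by exists (fine (maxplus_mul A (\col_k (x k)%:E) i ord0)); apply/attainsP.
rewrite fin_numE; apply/andP; split.
  rewrite -ltNye mxE; apply: lt_le_trans (le_bigmax _ _ j).
  by rewrite mxE -(fineK Aij) -EFinD ltNyr.
rewrite -ltey mxE; apply: bigmax_lt => // k _.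
by rewrite mxE lte_add_pinfty ?ltry // ltey; apply/eqP.
Qed.

Lemma sol_setP (R : realType) m n (A B : 'M[\bar R]_(m, n)) x :
  Rmax_mx A -> doubly_astic A ->
  sol_set A B (\col_k (x k)%:E) <-> solves A B x.
Proof.
move=> AR [Arow _]; split=> [[_ AxBx] i|xS].
  have [c ax] := attains_exists x AR (Arow i).
  by exists c; split=> //; apply/attainsP; rewrite -AxBx; exact/attainsP.
split=> [k l|]; first by rewrite mxE.
apply/matrixP => i l; rewrite ord1; have [c [ax bx]] := xS i.
by rewrite ((attainsP _ _ _ _).1 ax) ((attainsP _ _ _ _).1 bx).
Qed.

(** * Monotonicity and fixed points of the alternating method *)

Lemma dual_adde_le2 (R : realType) (a x y : \bar R) :
  (x <= y)%E -> (dual_adde a x <= dual_adde a y)%E.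
Proof.
by case: a x y => [r| |] [s| |] [t| |] //=; rewrite /dual_adde ?leey ?leNye //;
  rewrite !lee_fin lerD2l.
Qed.

Lemma phi0E (R : realType) m n (A B : 'M[\bar R]_(m, n)) x j :
  phi0 A B x j ord0 = \big[mine/+oo%E]_(i < m)
    dual_adde (- maxe (A i j) (B i j))%E
      (mine (maxplus_mul A x i ord0) (maxplus_mul B x i ord0)).
Proof. by rewrite mxE; apply: eq_bigr => i _; rewrite !mxE oppe_max. Qed.

Lemma maxplus_mul_le (R : realType) m n (A : 'M[\bar R]_(m, n))
    (x y : 'cV[\bar R]_n) i :
  (forall j, x j ord0 <= y j ord0)%E ->
  (maxplus_mul A x i ord0 <= maxplus_mul A y i ord0)%E.
Proof. by move=> xy; rewrite !mxE; apply: le_bigmax2 => j _; apply: leeD2l. Qed.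

Lemma iter_phi0_le (R : realType) m n (A B : 'M[\bar R]_(m, n)) r
    (x y : 'cV[\bar R]_n) :
  (forall j, x j ord0 <= y j ord0)%E ->
  forall j, (iter r (phi0 A B) x j ord0 <= iter r (phi0 A B) y j ord0)%E.
Proof.
move=> xy; elim: r => //= r IHr j; rewrite !phi0E; apply: le_bigmin2 => i _.
apply: dual_adde_le2; rewrite le_min !ge_min.
by rewrite !maxplus_mul_le ?orbT.
Qed.

(* The residuation [A x <= y <-> x <= - A^T y], applied to both sides of each
   equation: a real fixed point has [max (A x) (B x) <= min (A x) (B x)]. *)
Lemma stable_solves (R : realType) m n (A B : 'M[\bar R]_(m, n)) v :
  Rmax_mx A -> Rmax_mx B -> doubly_astic A -> doubly_astic B ->
  stable A B (\col_k (v k)%:E) -> solves A B v.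
Proof.
move=> AR BR [Arow _] [Brow _] stv i.
have [c av] := attains_exists v AR (Arow i).
have [d bv] := attains_exists v BR (Brow i).
have bound k : (maxe (A i k) (B i k) <= (Num.min c d - v k)%:E)%E.
  have : (v k)%:E = phi0 A B (\col_k (v k)%:E) k ord0 by rewrite stv mxE.
  move=> /eqP; rewrite phi0E eq_le => /andP[+ _].
  move=> /le_trans /(_ (bigmin_le _ i _)).
  rewrite ((attainsP _ _ _ _).1 av) ((attainsP _ _ _ _).1 bv) -EFin_min.
  case: (maxe _ _) => [r| |] /=; rewrite /dual_adde //= ?leNye //.
  by rewrite !lee_fin; lra.
(* A column active on the left has entry [c - v k], which the bound compares with
   [Num.min c d - v k]. *)
have cd : c <= d.
  have [k kE] := av.2; have := bound k; rewrite ge_max kE lee_fin => /andP[+ _].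
  by case: (leP c d); lra.
have dc : d <= c.
  have [k kE] := bv.2; have := bound k; rewrite ge_max kE lee_fin => /andP[_].
  by case: (leP c d); lra.
by exists c; split=> //; rewrite (_ : c = d) //; lra.
Qed.

(** As [C_i <= - A_i], the product of [A_i] with [C_i^T] is at most 0, so the [i]-th term of the
    minimum in [phi0] is at most [C_ij]. By monotonicity all iterates from [C_i^T] then stay below
    it. *)
Lemma phi0_row_le (R : realType) m n (A B : 'M[\bar R]_(m, n)) i j :
  Rmax_mx A ->
  (phi0 A B (row i (neg_mx (maxplus_add A B)))^T j ord0 <=
   (row i (neg_mx (maxplus_add A B)))^T j ord0)%E.
Proof.
move=> AR; rewrite phi0E; apply: le_trans (bigmin_le _ i _) _.
set c := (row i _)^T; have cE k : c k ord0 = (- maxe (A i k) (B i k))%E.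
  by rewrite !mxE.
apply: (@le_trans _ _ (dual_adde (- maxe (A i j) (B i j)) 0)%E).
  apply: dual_adde_le2; rewrite ge_min; apply/orP; left.
  rewrite mxE; apply: bigmax_le => [|k _]; first exact: leNye.
  rewrite cE; apply: (@le_trans _ _ (A i k - A i k)%E).
    by apply: leeD2l; rewrite leeN2 le_max lexx.
  (* The difference is 0 for a real entry, and [-oo] for the entry [-oo] by the convention of the
     addition of [\bar R]. *)
  have := AR i k; case: (A i k) => [r| |] // _.
  - by rewrite -EFinB subrr.
  - exact: leNye.
rewrite cE; case: (- _)%E => [r| |] //.
by rewrite /dual_adde /= addr0.
Qed.

(** * The limits of the alternating method as generators *)

(** At [v] the value is 0, reached only at [p]. Another column [k] active at [x] would give
    [v k < x k - c], against the upper bound on [x]. *)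
Lemma strictly_active_pinned (R : realType) (T : finType) (f : T -> \bar R)
    (x v : T -> R) c p :
  f p = (0 - v p)%:E ->
  (forall k, k != p -> f k + (v k)%:E < f p + (v p)%:E)%E ->
  attains f x c -> (forall k, x k <= c + v k) -> x p = c + v p.
Proof.
move=> pE strict [_ [k kE]] le_v.
have [kp|/strict] := eqVneq k p.
  by move: kE; rewrite kp pE => -[]; lra.
by rewrite kE pE -!EFinD lte_fin; have := le_v k; lra.
Qed.

Lemma attains_shift (R : realType) (T : finType) (f : T -> \bar R) x c e :
  attains f x c -> attains f (fun k => x k + e) (c + e).
Proof.
move=> [ub [k kE]]; split=> [j|]; last by exists k; rewrite kE; congr EFin; lra.
by apply: le_trans (ub j) _; rewrite lee_fin; lra.
Qed.

Lemma solves_shift (R : realType) (I T : finType) (a b : I -> T -> \bar R) x e :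
  solves a b x -> solves a b (fun k => x k + e).
Proof.
move=> xS i; have [c [ax bx]] := xS i.
by exists (c + e); split; exact: attains_shift.
Qed.

Lemma phi_fixed (R : realType) m n (A B : 'M[\bar R]_(m, n)) x
    (h : phi_defined A B x) : stable A B (phi h).
Proof. by rewrite /stable /phi; case: ex_minnP => r /eqP. Qed.

Lemma phi_generators (R : realType) m n (A B : 'M[\bar R]_(m, n))
    (C := neg_mx (maxplus_add A B))
    (C_defined : forall i : 'I_m, phi_defined A B (row i C)^T) :
  Rmax_mx A -> Rmax_mx B -> doubly_astic A -> doubly_astic B ->
  (forall x, sol_set A B x -> stable A B x) ->
  (forall i, Rset (row i A) (row i B) (phi (C_defined i))) ->
  generators A B (fun i k => fine (phi (C_defined i) k ord0)).
Proof.
move=> AR BR Aast Bast S_stable C_R.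
pose v i k := fine (phi (C_defined i) k ord0); rewrite -/v.
have vE i : phi (C_defined i) = \col_k (v i k)%:E.
  have [phi_real _ _] := C_R i.
  by apply/matrixP => k l; rewrite ord1 mxE fineK.
have vS i : solves A B (v i).
  by apply: stable_solves => //; rewrite -vE; exact: phi_fixed.
have CE i k : (row i C)^T k ord0 = (- maxe (A i k) (B i k))%E by rewrite !mxE.
have v_max0 i x k : solves A B x -> attains (A i) x 0 -> x k <= v i k.
  move=> xS ax; have [c [ax' bx]] := xS i.
  have := attains_uniq ax' ax => c0; rewrite {c ax'}c0 in bx.
  (* A solution is fixed by [phi0], so monotonicity keeps it below every iterate from [C_i^T]. *)
  have xE r : \col_k (x k)%:E = iter r (phi0 A B) (\col_k (x k)%:E).
    elim: r => //= r <-; symmetry; apply: S_stable; exact/sol_setP.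
  have : ((\col_k (x k)%:E) k ord0 <= phi (C_defined i) k ord0)%E.
    rewrite /phi (xE (ex_minn (C_defined i))); apply: iter_phi0_le => j.
    rewrite CE leeNr ge_max mxE -EFinN.
    by have := ax.1 j; have := bx.1 j; rewrite !sub0r => -> ->.
  by rewrite vE !mxE lee_fin.
have v_max i x c k : solves A B x -> attains (A i) x c -> x k <= c + v i k.
  move=> xS ax.
  (* Subtracting [c] normalizes the row value to 0. *)
  have := @v_max0 i (fun k => x k - c) k (solves_shift _ xS).
  have := attains_shift (- c) ax; rewrite subrr => ax0 /(_ ax0); lra.
have v_leC i k : (v i k)%:E = phi (C_defined i) k ord0 by rewrite vE mxE.
have v_le i k : (maxe (A i k) (B i k) <= (- v i k)%:E)%E.
  rewrite EFinN leeNr v_leC /phi -CE.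
  elim: (ex_minn _) k => //= r IHr k.
  apply: le_trans (phi0_row_le B i k AR).
  exact: (iter_phi0_le A B 1 IHr).
have av0 i : attains (A i) (v i) 0 /\ attains (B i) (v i) 0.
  have [c [av bv]] := vS i i; suff c0 : c = 0 by rewrite c0 in av bv.
  (* Maximality applied to [v i] itself gives [0 <= c]; at an active column, [v i <= C_i] gives
     [c <= 0]. *)
  have [k kE] := av.2; have := v_max _ _ _ k (vS i) av.
  by have := v_le i k; rewrite ge_max kE lee_fin => /andP[+ _]; lra.
split=> // [i|i|i]; [by case: (av0 i)|by case: (av0 i)|].
have [av bv] := av0 i.
have termE (M : 'M[\bar R]_(m, n)) k :
    term (row i M) (phi (C_defined i)) k = (M i k + (v i k)%:E)%E.
  by rewrite /term mxE v_leC.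
have activeE (M : 'M[\bar R]_(m, n)) k : attains (M i) (v i) 0 ->
    dot (row i M) (phi (C_defined i)) = term (row i M) (phi (C_defined i)) k <->
    M i k = (0 - v i k)%:E.
  move=> Mv; rewrite termE.
  have -> : dot (row i M) (phi (C_defined i)) = 0%:E.
    rewrite -((attainsP _ _ _ _).1 Mv) /dot -vE !mxE.
    by apply: eq_bigr => j _; rewrite mxE.
  by split=> [/esym/add_eq_EFin|/add_eq_EFin].
have pinned (M : 'M[\bar R]_(m, n)) p :
    M i p = (0 - v i p)%:E ->
    (forall k, k != p -> (term (row i M) (phi (C_defined i)) k <
                          term (row i M) (phi (C_defined i)) p)%E) ->
    forall x c, solves A B x -> attains (A i) x c -> attains (M i) x c ->
      x p = c + v i p.
  move=> pE strict x c xS ax Mx; apply: strictly_active_pinned pE _ Mx _.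
    by move=> k kp; have := strict k kp; rewrite !termE.
  by move=> k; exact: v_max.
have bE x c : solves A B x -> attains (A i) x c -> attains (B i) x c.
  by move=> xS ax; have [d [/attains_uniq/(_ ax)->]] := xS i.
have [_ _ [[p [q]]|[p]|same]] := C_R i.
- move=> [_ /(activeE _ _ av) pE pS /(activeE _ _ bv) qE qS].
  left; exists p, q; split=> // x c xS ax; split.
    exact: (pinned A p pE pS x c xS ax ax).
  exact: (pinned B q qE qS x c xS ax (bE x c xS ax)).
- move=> [/(activeE _ _ av) pE /(activeE _ _ bv) qE qS].
  (* In case (2) strictness on the right alone pins [p], which is also active on the left, so [p]
     serves both sides. *)
  left; exists p, p; split=> // x c xS ax.
  by have := pinned B p qE qS x c xS ax (bE x c xS ax).
- by right=> k; rewrite -(activeE _ _ av) -(activeE _ _ bv).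
Qed.

Unset Implicit Arguments.

Theorem theorem5p7 (R : realType) (m n : nat) (A B : 'M[\bar R]_(m, n))
  (A_Rmax : Rmax_mx A) (B_Rmax : Rmax_mx B)
  (A_astic : doubly_astic A) (B_astic : doubly_astic B)
  (S_stable : forall x, sol_set A B x -> stable A B x)
  (S_bounded : projectively_bounded (sol_set A B))
  (C := neg_mx (maxplus_add A B))
  (C_defined : forall i : 'I_m, phi_defined A B (row i C)^T)
  (C_R : forall i : 'I_m, Rset (row i A) (row i B) (phi (C_defined i))) :
  minplus_linear (sol_set A B).
Proof.
have gens := phi_generators A_Rmax B_Rmax A_astic B_astic S_stable C_R.
(* Projective boundedness leaves only real vectors once the all-[-oo] vector is removed. *)
have realE x : (sol_set A B `\` [set const_mx -oo%E])%classic x ->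
    exists2 u, x = \col_k (u k)%:E & solves A B u.
  move=> [xS xNy]; have [x_real|//] := S_bounded _ xS.
  have xE : x = \col_k (fine (x k ord0))%:E.
    by apply/matrixP => k l; rewrite ord1 mxE fineK.
  exists (fun k => fine (x k ord0)) => //.
  by apply/sol_setP => //; rewrite -xE.
(* The side condition excludes [n = 0], where every column is [const_mx -oo]. *)
have intro (x : 'cV[\bar R]_n) w : x <> const_mx -oo%E -> solves A B w ->
    ((sol_set A B `\` [set const_mx -oo%E]) `|` [set const_mx +oo%E])%classic
      (\col_k (w k)%:E).
  move=> xNy wS; left; split; first exact/sol_setP.
  move=> wNy; apply: xNy; apply/matrixP => k l.
  by move/matrixP: wNy => /(_ k ord0); rewrite !mxE.
split.
  move=> x y [xV|->] [yV|->].
  - have [u uE uS] := realE x xV; have [w wE wS] := realE y yV.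
    rewrite (_ : minplus_add x y = \col_k (Num.min (u k) (w k))%:E).
      by apply: (intro x) (solves_min gens uS wS); case: xV.
    by apply/matrixP => k l; rewrite uE wE !mxE EFin_min.
  - by left; rewrite (_ : minplus_add _ _ = x) //; apply/matrixP => k l;
      rewrite !mxE min_l ?leey.
  - by left; rewrite (_ : minplus_add _ _ = y) //; apply/matrixP => k l;
      rewrite !mxE min_r ?leey.
  - by right; apply/matrixP => k l; rewrite !mxE minxx.
move=> [e| |] // x _ [xV|->].
- have [u uE uS] := realE x xV.
  rewrite (_ : minplus_scale e%:E x = \col_k (u k + e)%:E).
    by apply: (intro x) (solves_shift _ uS); case: xV.
  by apply/matrixP => k l; rewrite uE !mxE addrC.
- by right; apply/matrixP => k l; rewrite !mxE.
(* For the scalar [+oo], dual addition sends every entry to [+oo]. *)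
- by right; apply/matrixP => k l; rewrite !mxE.
- by right; apply/matrixP => k l; rewrite !mxE.
Qed.
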